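(* Let $q$ be an odd integer with $q \equiv 1 \pmod 4$, and let $s = q-2$ (so $s$ is an odd integer with $s \equiv 3 \pmod 4$). If there exists a skew Hadamard matrix of order $s+1$ and there exists a circulant conference matrix of order $q$, then there exists a Hadamard matrix of order $2q(s+1)$.
   Context: A Hadamard matrix of order $n$ is an $n\times n$ matrix $H$ with entries in $\{-1,1\}$ such that $HH^T = H^TH = nI_n$. A skew Hadamard matrix is a Hadamard matrix $H$ of the form $H = S + I$ with $S$ skew-symmetric ($S^T=-S$). Write $J_q$ for the $q\times q$ all-ones matrix. In this paper a conference matrix of order $q$ means a $q\times q$ matrix $C_q$ with zero diagonal, entries $\pm 1$ off the diagonal, satisfying $C_qC_q^T = qI_q - J_q$ and $C_qJ_q = J_qC_q = 0$ (for example, for a prime power $q$, the matrix $C_q=[\chi(\alpha_j-\alpha_i)]_{i,j}$ where $\chi$ is the quadratic character of $GF(q)=\{\alpha_1,\dots,\alpha_q\}$ with $\chi(0)=0$). A matrix is circulant if each row is the cyclic shift by one position to the right of the previous row. *)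

(* Defs.v *)
From HB Require Import structures.
From mathcomp Require Import all_boot all_order all_algebra.

Set Implicit Arguments.
Unset Strict Implicit.
Unset Printing Implicit Defensive.

Import GRing.Theory.
Local Open Scope ring_scope.

Definition all_ones (n : nat) : 'M[int]_n := const_mx 1.

Definition hadamard (n : nat) (H : 'M[int]_n) : Prop :=
  [/\ forall i j, H i j = 1 \/ H i j = -1,
      H *m H^T = (n%:R)%:M
    & H^T *m H = (n%:R)%:M].

Definition skew_hadamard (n : nat) (H : 'M[int]_n) : Prop :=
  hadamard H /\ exists S : 'M[int]_n, S^T = - S /\ H = S + 1%:M.

(* This is the core-type normalisation C C^T = n I - J with zero row and column
   sums, not the more common C C^T = (n - 1) I. *)
Definition conference (n : nat) (C : 'M[int]_n) : Prop :=
  [/\ forall i, C i i = 0,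
      forall i j, i != j -> C i j = 1 \/ C i j = -1,
      C *m C^T = (n%:R)%:M - all_ones n,
      C *m all_ones n = 0
    & all_ones n *m C = 0].

(* ordS is the successor modulo n, so row i + 1 is row i shifted cyclically one
   position to the right. *)
Definition circulant (n : nat) (C : 'M[int]_n) : Prop :=
  forall i j : 'I_n, C (ordS i) (ordS j) = C i j.

(* Main.v *)
Require Import Defs.
From HB Require Import structures.
From mathcomp Require Import all_boot all_order all_algebra.
From mathcomp Require Import ring zify.
From mathcomp.real_closed Require Import mxtens.

(** Write [H = S + I].  Then [S S^T = s I], so [I (x) X + S (x) Y] is a Hadamard
    matrix as soon as [X] and [Y] are sign matrices of order [2 q] such that
    [Y X^T] is symmetric and [X X^T + s Y Y^T = 2 q (s + 1) I].  A conference
    matrix [C] of order [q = 1 mod 4] is symmetric, and with [s = q - 2] the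
    choice
      [X = [[J, J - 2 I], [2 I - J, J]]],  [Y = [[C + I, C - I], [C - I, - C - I]]]
    works: [X X^T] and [Y Y^T] are block diagonal, with diagonal blocks
    [4 I + 2 (q - 2) J] and [2 (q + 1) I - 2 J]. *)

Set Implicit Arguments.
Unset Strict Implicit.
Unset Printing Implicit Defensive.

Import GRing.Theory Num.Theory.
Local Open Scope ring_scope.

Definition sign_mx (m n : nat) (A : 'M[int]_(m, n)) : Prop :=
  forall i j, A i j = 1 \/ A i j = -1.

Lemma sign_mx_opp (m n : nat) (A : 'M[int]_(m, n)) : sign_mx A -> sign_mx (- A).
Proof. by move=> sA i j; rewrite mxE; case: (sA i j) => ->; [right | left]. Qed.

Lemma sign_block_mx (m1 m2 n1 n2 : nat) (A : 'M[int]_(m1, n1))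
    (B : 'M[int]_(m1, n2)) (C : 'M[int]_(m2, n1)) (D : 'M[int]_(m2, n2)) :
  sign_mx A -> sign_mx B -> sign_mx C -> sign_mx D ->
  sign_mx (block_mx A B C D).
Proof.
move=> sA sB sC sD i j; rewrite -[i]splitK -[j]splitK.
case: (split i) => i'; case: (split j) => j' /=.
- by rewrite block_mxEul.
- by rewrite block_mxEur.
- by rewrite block_mxEdl.
- by rewrite block_mxEdr.
Qed.

(** Associativity gives [(A^T *m A - c%:M) *m A^T = 0]. As [\det A] divides [c ^+ n], it is nonzero,
    so multiplying by the adjugate cancels [A^T] although it may have no inverse over [R]. *)
Lemma gram_trC (R : idomainType) (n : nat) (A : 'M[R]_n) (c : R) :
  c != 0 -> A *m A^T = c%:M -> A^T *m A = c%:M.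
Proof.
move=> c0 AAt.
have dA : \det A != 0.
  apply: contraNneq (expf_neq0 n c0) => dA.
  by rewrite -det_scalar -AAt det_mulmx dA mul0r.
have: (A^T *m A - c%:M) *m A^T *m \adj A^T = 0.
  by rewrite mulmxBl -[X in X - _]mulmxA AAt mul_scalar_mx mul_mx_scalar
             subrr mul0mx.
rewrite -mulmxA mul_mx_adj det_tr mul_mx_scalar => /eqP.
by rewrite scalemx_eq0 (negPf dA) subr_eq0 => /eqP.
Qed.

(** In [(S + I)(S^T + I)] the linear terms [S] and [S^T] cancel. *)
Lemma skew_hadamard_gram (n : nat) (H S : 'M[int]_n) :
  hadamard H -> S^T = - S -> H = S + 1%:M -> S *m S^T = (n%:R - 1)%:M.
Proof.
move=> [_ HHt _] St defH; move: HHt.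
rewrite defH linearD /= trmx1 mulmxDl !mulmxDr !mul1mx !mulmx1 => HHt.
by rewrite raddfB /= -HHt St; apply/matrixP=> i j; rewrite !mxE; ring.
Qed.

Lemma skew_diag0 (n : nat) (S : 'M[int]_n) : S^T = - S -> forall i, S i i = 0.
Proof.
by move=> /matrixP/[swap] i /(_ i i); rewrite !mxE; move: (S i i) => x; lia.
Qed.

Lemma hadamard_tens (n m : nat) (H : 'M[int]_n) (X Y : 'M[int]_m) :
  (0 < n * m)%N -> skew_hadamard H -> sign_mx X -> sign_mx Y ->
  Y *m X^T = X *m Y^T ->
  X *m X^T + (n%:R - 1) *: (Y *m Y^T) = ((n * m)%:R)%:M ->
  exists K : 'M[int]_(n * m), hadamard K.
Proof.
move=> nm0 [hH [S [St defH]]] sX sY YX XY.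
have SSt := skew_hadamard_gram hH St defH.
pose K := 1%:M *t X + S *t Y.
(* The mixed terms are [S *t (Y *m X^T)] and [S^T *t (X *m Y^T)]; they cancel because [S] is skew
   and [Y *m X^T = X *m Y^T]. *)
have KKt : K *m K^T = ((n * m)%:R)%:M.
  rewrite /K linearD /= !trmx_tens trmx1 mulmxDl !mulmxDr !tensmx_mul.
  rewrite !mul1mx !mulmx1 SSt YX St.
  apply/matrixP=> i j.
  case: (mxtens_indexP i) => i1 i2; case: (mxtens_indexP j) => j1 j2.
  move/matrixP/(_ i2 j2): XY; rewrite !mxE !mxtens_indexK /=.
  rewrite (can_eq (@mxtens_indexK n m)) xpair_eqE /= => XY.
  case: (i1 == j1); rewrite /= ?mulr0n ?mulr1n; last by ring.
  by rewrite -XY; ring.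
exists K; split=> //; last by apply: gram_trC => //; rewrite pnatr_eq0 -lt0n.
move=> i j; rewrite !mxE.
set i1 := (mxtens_unindex i).1; set j1 := (mxtens_unindex j).1.
set i2 := (mxtens_unindex i).2; set j2 := (mxtens_unindex j).2.
(* The diagonal blocks of [K] are copies of [X], since [S] has zero diagonal; off the diagonal [S]
   agrees with [H], so the blocks there are [Y] or [- Y]. *)
have [<-|ij] := eqVneq i1 j1.
  by rewrite (skew_diag0 St) mulr1n mul1r mul0r addr0; apply: sX.
have [/(_ i1 j1) sH _ _] := hH.
move: sH; rewrite defH !mxE (negPf ij) !mulr0n addr0 mul0r add0r.
by case=> ->; case: (sY i2 j2) => ->; [left | right | right | left].
Qed.

(* For signs x and y, 4 divides (x - 1)(y - 1).  Summing over the columns k of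
   rows i and j gives q - 1, while the columns i and j together contribute
   2 - C i j - C j i. *)
Lemma conference_sym (q : nat) (C : 'M[int]_q) :
  q = 1 %[mod 4] -> conference C -> C^T = C.
Proof.
move=> q4 [C0 Cs CCt CJ _]; apply/matrixP=> i j; rewrite mxE.
have [->//|ij] := eqVneq i j.
have rowsum k : \sum_l C k l = 0.
  move/matrixP/(_ k i): CJ; rewrite !mxE; apply: etrans.
  by apply: eq_bigr => l _; rewrite mxE mulr1.
have dotp : \sum_l C i l * C j l = -1.
  move/matrixP/(_ i j): CCt; rewrite !mxE (negPf ij) mulr0n sub0r; apply: etrans.
  by apply: eq_bigr => l _; rewrite mxE.
have tot : \sum_l (C i l - 1) * (C j l - 1) = q%:R - 1.
  transitivity (\sum_l (C i l * C j l - C i l - C j l + 1)).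
    by apply: eq_bigr => l _; ring.
  rewrite !big_split /= !sumrN !rowsum dotp sumr_const card_ord; ring.
have div4 : (4 %| \sum_(l | (l != i) && (l != j))
                    (C i l - 1) * (C j l - 1))%Z.
  apply: rpred_sum => l /andP[li lj].
  have [] := Cs i l; rewrite 1?eq_sym // => ->; last first.
    by have [] := Cs j l; rewrite 1?eq_sym // => ->.
  by rewrite subrr mul0r.
move: tot; rewrite (bigD1 i) //= (bigD1 j) 1?eq_sym //= !C0.
move: div4; set T := \sum_(_ | _) _ => /dvdzP[k ->].
(* If [C i j] and [C j i] had opposite signs, then [2 + 4 k = q - 1], against [q = 1] modulo 4. *)
have [] := Cs i j ij; have [] := Cs j i; rewrite 1?eq_sym // => -> ->; lia.
Qed.

Lemma mul_all_ones (q : nat) :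
  all_ones q *m all_ones q = q%:R *: all_ones q.
Proof.
apply/matrixP=> i j; rewrite !mxE.
under eq_bigr do rewrite !mxE mulr1.
by rewrite sumr_const card_ord mulr1.
Qed.

Lemma hadamard_conference_skew (q n : nat) (H : 'M[int]_n) (C : 'M[int]_q) :
  q = 1 %[mod 4] -> n.+1 = q -> (0 < n)%N ->
  skew_hadamard H -> conference C -> exists K : 'M[int]_(n * (q + q)), hadamard K.
Proof.
move=> q4 nq n0 hH hC; have Ct := conference_sym q4 hC.
case: hC => C0 Cs; rewrite Ct; set J := all_ones q => CC CJ JC.
have Jt : J^T = J by apply/matrixP=> i j; rewrite !mxE.
have JJ : J *m J = q%:R *: J := mul_all_ones q.
pose P := C + 1%:M; pose Q := C - 1%:M; pose B := J - 2%:M.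
have Pt : P^T = P by rewrite /P linearD /= Ct trmx1.
have Qt : Q^T = Q by rewrite /Q linearB /= Ct trmx1.
have Bt : B^T = B by rewrite /B linearB /= Jt tr_scalar_mx.
have sP : sign_mx P.
  move=> i j; rewrite !mxE; have [<-|ij] := eqVneq i j.
    by left; rewrite C0 add0r.
  by rewrite addr0; apply: Cs.
have sQ : sign_mx Q.
  move=> i j; rewrite !mxE; have [<-|ij] := eqVneq i j.
    by right; rewrite C0 add0r.
  by rewrite subr0; apply: Cs.
have sJ : sign_mx J by move=> i j; left; rewrite mxE.
have sB : sign_mx B.
  move=> i j; rewrite !mxE; case: (i == j); first by right.
  by left; rewrite mulr0n subr0.
(* [P], [Q], [J] and [B] are symmetric, so these commutations make [Y *m X^T] symmetric and the
   off-diagonal blocks of both Gram matrices zero. *)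
have PQ : P *m Q = Q *m P.
  by rewrite /P /Q mulmxDl mulmxBl !mulmxDr !mulmxN !mul1mx !mulmx1;
     apply/matrixP=> i j; rewrite !mxE; ring.
have JB : J *m B = B *m J.
  by rewrite /B mulmxBl mulmxBr mul_mx_scalar mul_scalar_mx.
have PJ : P *m J = J by rewrite /P mulmxDl CJ add0r mul1mx.
have JP : J *m P = J by rewrite /P mulmxDr JC add0r mulmx1.
have QJ : Q *m J = - J by rewrite /Q mulmxBl CJ sub0r mul1mx.
have JQ : J *m Q = - J by rewrite /Q mulmxBr JC sub0r mulmx1.
have PB : P *m B = B *m P.
  by rewrite /B (mulmxBr P) (mulmxBl J) mul_mx_scalar mul_scalar_mx PJ JP.
have QB : Q *m B = B *m Q.
  by rewrite /B (mulmxBr Q) (mulmxBl J) mul_mx_scalar mul_scalar_mx QJ JQ.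
have BB : B *m B = (q%:R - 4) *: J + 4%:M.
  rewrite /B mulmxBl !mulmxBr JJ mul_mx_scalar !mul_scalar_mx scale_scalar_mx.
  by apply/matrixP=> i j; rewrite !mxE; case: (i == j); ring.
(* The terms [2 C] and [- 2 C] of the two squares cancel, leaving [2 C^2 + 2 I]. *)
have PPQQ : P *m P + Q *m Q = (2 * q%:R + 2)%:M - 2 *: J.
  rewrite /P /Q !mulmxDl !mulmxDr !mulmxN !mulNmx !mul1mx !mulmx1 CC.
  by apply/matrixP=> i j; rewrite !mxE; case: (i == j); ring.
apply: (@hadamard_tens n (q + q) H (block_mx J B (- B) J)
                                   (block_mx P Q Q (- P))) => //.
- by rewrite muln_gt0 n0 -nq.
- by apply: sign_block_mx => //; apply: sign_mx_opp.
- by apply: sign_block_mx => //; apply: sign_mx_opp.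
- rewrite !tr_block_mx !linearN /= Jt Bt Pt Qt !mulmx_block.
  rewrite !mulmxN !mulNmx PJ JP QJ JQ PB QB.
  by congr block_mx; rewrite ?opprK // addrC.
- rewrite !tr_block_mx !linearN /= Jt Bt Pt Qt !mulmx_block.
  rewrite !mulmxN !mulNmx !opprK JB PQ !subrr addNr scale_block_mx add_block_mx.
  rewrite [B *m B + _]addrC [Q *m Q + _]addrC PPQQ JJ BB scaler0 addr0.
  rewrite [RHS]scalar_mx_block.
  (* With [n = q - 1], the coefficient [2 q - 4 - 2 (n - 1)] of [J] vanishes and the scalar part
     [4 + (n - 1)(2 q + 2)] equals [2 q n]. *)
  have -> : q%:R *: J + ((q%:R - 4) *: J + 4%:M)
      + (n%:R - 1) *: ((2 * q%:R + 2)%:M - 2 *: J) = (n * (q + q))%:R%:M.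
    rewrite natrM natrD; have -> : q%:R = n%:R + 1 :> int by rewrite natr1 nq.
    by apply/matrixP=> i j; rewrite !mxE; case: (i == j); ring.
  by [].
Qed.

Local Close Scope ring_scope.

Theorem theorem3p1 (q s : nat)
    (hq_odd : odd q) (hq_mod : q = 1 %[mod 4]) (hqs : q = s + 2)
    (hskew : exists H : 'M[int]_(s + 1), skew_hadamard H)
    (hconf : exists C : 'M[int]_q, conference C /\ circulant C) :
  exists H : 'M[int]_(2 * q * (s + 1)), hadamard H.
Proof.
have [H hH] := hskew; have [C [hC _]] := hconf.
have -> : (2 * q * (s + 1) = (s + 1) * (q + q))%N by rewrite mulnC mul2n addnn.
by apply: hadamard_conference_skew hH hC; rewrite // ?addn1 // hqs addn2.
Qed.
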